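(* Let $A$ be a ring of characteristic $0$ whose group of units $A^*$ is finite. Then $\epsilon(A)\in\{1,2\}$ and $$A^*\cong \mathbb{Z}/2^{\epsilon(A)}\mathbb{Z}\times H$$ for some finite abelian group $H$.
   Context: Rings are commutative with $1\neq 0$. $A^*$ denotes the multiplicative group of invertible elements of $A$. For a ring $A$ with $A^*$ finite (and of even order, which is automatic in characteristic $0$), write the 2-Sylow subgroup of $A^*$ as a direct sum of nontrivial cyclic groups $\mathbb{Z}/2^{e_1}\mathbb{Z}\oplus\dots\oplus\mathbb{Z}/2^{e_s}\mathbb{Z}$ with all $e_i\ge 1$; then $\epsilon(A):=\min_i e_i$. *)

(* Defs.v *)
From HB Require Import structures.
From mathcomp Require Import all_boot all_order all_algebra all_fingroup.
From mathcomp Require Import all_solvable finmap.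
From mathcomp Require Import boolp classical_sets cardinality.

Set Implicit Arguments.
Unset Strict Implicit.
Unset Printing Implicit Defensive.

Import GroupScope GRing.Theory.

(* [pchar R] =i pred0 is too weak for a general ring: it only says that no
   prime vanishes in R, and so holds for instance in Z/4Z. *)
Definition characteristic0 (R : nzRingType) : Prop :=
  forall n : nat, (n%:R = 0 :> R)%R -> n = 0%N.

Definition units (A : comUnitRingType) : classical_sets.set A :=
  [set x : A | x \is a GRing.unit]%classic.
Arguments units A : clear implicits.

(* {unit A} is only available when A itself is finite. Here A may be infinite,
   and the proof that its units are finitely many is a parameter of the type,
   from which the finite group structure is inferred. *)
Inductive unit_group (A : comUnitRingType) (finU : finite_set (units A)) :=
  UnitGroup (x : A) of x \is a GRing.unit.

Section UnitGroup.

Variables (A : comUnitRingType) (finU : finite_set (units A)).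
Local Notation unit_group := (unit_group finU).

Definition unit_group_val (u : unit_group) : A := let: UnitGroup x _ := u in x.

HB.instance Definition _ := [isSub for unit_group_val].
HB.instance Definition _ := [Choice of unit_group by <:].

Let enumU : seq A := fset_set (units A).

Fact mem_enumU (u : unit_group) : val u \in enumU.
Proof. by rewrite in_fset_set ?inE //; apply: (valP u). Qed.

Let to_sub (u : unit_group) : seq_sub enumU := SeqSub (mem_enumU u).
Let of_sub (x : seq_sub enumU) : option unit_group := insub (val x).

Fact to_subK : pcancel to_sub of_sub.
Proof. by move=> u; rewrite /of_sub /= valK. Qed.

HB.instance Definition _ : isCountable unit_group := PCanIsCountable to_subK.
HB.instance Definition _ : isFinite unit_group := PCanIsFinite to_subK.

Definition ug_one : unit_group := UnitGroup finU (GRing.unitr1 A).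

Fact ug_inv_subproof (u : unit_group) : (val u)^-1%R \is a GRing.unit.
Proof. by rewrite unitrV; apply: (valP u). Qed.
Definition ug_inv (u : unit_group) := UnitGroup finU (ug_inv_subproof u).

Fact ug_mul_subproof (u v : unit_group) : (val u * val v)%R \is a GRing.unit.
Proof. by rewrite unitrM (valP u) (valP v). Qed.
Definition ug_mul (u v : unit_group) := UnitGroup finU (ug_mul_subproof u v).

Fact ug_mulA : associative ug_mul.
Proof. by move=> u v w; apply: val_inj; apply: mulrA. Qed.
Fact ug_mul1 : left_id ug_one ug_mul.
Proof. by move=> u; apply: val_inj; apply: mul1r. Qed.
Fact ug_mulV : left_inverse ug_one ug_inv ug_mul.
Proof. by move=> u; apply: val_inj; apply: (mulVr (valP u)). Qed.

HB.instance Definition _ :=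
  Finite_isGroup.Build unit_group ug_mulA ug_mul1 ug_mulV.

Lemma abelian_unit_group : abelian [set: unit_group].
Proof. by apply/centsP => u _ v _; apply: val_inj; apply: mulrC. Qed.

End UnitGroup.

Section Epsilon.

Variable gT : finGroupType.
Implicit Types (G P : {group gT}).

Definition sylow2 G : {group gT} := sval (Sylow_exists 2 G).

(* abelian_type lists the orders 2 ^ e_i (all > 1) of the cyclic factors of the
   2-Sylow subgroup; epsilonE below shows that epsilon does not depend
   on the choice of the decomposition. *)
Definition sylow2_exponents G : seq nat :=
  [seq logn 2 n | n <- abelian_type (sylow2 G)].

Definition minimum (e : seq nat) : nat := head 0 (sort leq e).

Definition epsilon G : nat := minimum (sylow2_exponents G).

Lemma minimum_in (e : seq nat) : e != [::] -> minimum e \in e.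
Proof.
move=> e0; rewrite /minimum -(mem_sort leq).
have: size (sort leq e) != 0 by rewrite size_sort size_eq0.
by case: (sort leq e) => //= n s _; rewrite mem_head.
Qed.

Lemma minimum_le (e : seq nat) n : n \in e -> minimum e <= n.
Proof.
rewrite /minimum -(mem_sort leq); have := sort_sorted leq_total e.
case: (sort leq e) => //= m s /(order_path_min leq_trans)/allP ms.
by rewrite inE => /predU1P[-> //|/ms].
Qed.

Lemma epsilonE G P (b : seq gT) (e : seq nat) :
    abelian G -> 2.-Sylow(G) P -> \big[dprod/1]_(x <- b) <[x]> = P ->
    map order b = map (expn 2) e -> all (leq 1) e ->
  epsilon G = minimum e.
Proof.
move=> cGG sylP defP ob e_gt0.
have defS : sylow2 G = P.
  apply/val_inj; have sylQ := svalP (Sylow_exists 2 G).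
  have nilG := abelian_nil cGG.
  by rewrite /= (nilpotent_Hall_pcore nilG sylQ) (nilpotent_Hall_pcore nilG sylP).
have b1 : 1 \notin b.
  apply/negP => /(map_f order); rewrite ob order1 => /mapP[n /(allP e_gt0)].
  by case: n => // n _; rewrite expnS => /esym/eqP; rewrite muln_eq1.
have pe := abelian_type_pgroup (pHall_pgroup sylP) defP b1.
congr (head 0%N _); apply/(perm_sortP leq_total leq_trans anti_leq).
rewrite /sylow2_exponents defS (perm_trans (perm_map _ pe)) // ob -map_comp.
by rewrite (eq_map (g := id)) ?map_id // => n /=; rewrite pfactorK.
Qed.

Lemma sylow2_exponents_exists G : abelian G ->
  exists b : seq gT,
    [/\ \big[dprod/1]_(x <- b) <[x]> = sylow2 G,
        map order b = map (expn 2) (sylow2_exponents G)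
      & all (leq 1) (sylow2_exponents G)].
Proof.
move=> cGG; have sylP := svalP (Sylow_exists 2 G); rewrite -/(sylow2 G) in sylP.
have [b defP ob] := abelian_structure (abelianS (pHall_sub sylP) cGG).
have ob2 n : n \in abelian_type (sylow2 G) -> n = (2 ^ logn 2 n)%N.
  rewrite -ob => /mapP[x xb ->]; rewrite -p_part part_pnat_id //.
  apply: mem_p_elt (pHall_pgroup sylP) _; rewrite -(bigdprodWY defP).
  by apply: mem_gen; rewrite (big_rem _ xb) inE cycle_id.
exists b; split=> //.
  by rewrite ob -map_comp -[LHS]map_id; apply/eq_in_map => n /ob2.
apply/allP => m /mapP[n n_in ->]; rewrite lt0n; apply/eqP => ln0.
by have := allP (abelian_type_gt1 (sylow2 G)) n n_in; rewrite /= (ob2 n n_in) ln0.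
Qed.

End Epsilon.

(* Main.v *)
Require Import Defs.
From mathcomp Require Import all_boot all_order all_algebra all_fingroup.
From mathcomp Require Import all_solvable.
From mathcomp Require Import cardinality ring.

(** The point is that, in characteristic 0 with finitely many units, -1 is not
    a fourth power. If [u ^+ 4 = -1], then the subring generated by [u] is an
    image of [Z[zeta_8]], where [s = zeta_8 + zeta_8^-1] is a square root of 2,
    so that [1 + s] is the fundamental unit [1 + sqrt 2]. It would have finite
    order; but its positive powers are [a + b * s] with positive integers [a]
    and [b], and [a + b * s = 1] gives [(a - 1) ^ 2 = 2 * b ^ 2], an equation
    between integers because the characteristic is 0, which contradicts the
    irrationality of [sqrt 2].

    On the other hand, in a direct product of cyclic groups of orders
    divisible by 8 every element of exponent 2 is a fourth power. Now -1 has
    order 2, hence lies in the 2-Sylow subgroup of the group of units, and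
    therefore some cyclic factor of this subgroup has order 2 or 4. This bounds
    [epsilon]; splitting off a factor of minimal order gives the isomorphism. *)

Set Implicit Arguments.
Unset Strict Implicit.
Unset Printing Implicit Defensive.

Import GroupScope GRing.Theory.

(** The irrationality of the square root of 2: the 2-adic valuations of the two
    sides have different parities. *)
Lemma double_square_neq_square (m n : nat) :
  (0 < n)%N -> (m ^ 2 != 2 * n ^ 2)%N.
Proof.
move=> n_gt0; apply/eqP => /(congr1 (fun k => odd (logn 2 k))).
by rewrite lognM ?expn_gt0 ?n_gt0 // !lognX !mul2n oddD !odd_double.
Qed.

Section SquareRootOfTwo.

Local Open Scope ring_scope.

Variables (A : comUnitRingType) (s : A).
Hypothesis s2 : s ^+ 2 = 2%:R.

(** Positivity of the coefficient of [s] keeps these powers away from 1; that of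
    the other coefficient lets 1 be subtracted from it within [nat]. *)
Lemma exp_1_add_sqrt2 n :
  exists a b : nat, (1 + s) ^+ n.+1 = a.+1%:R + b.+1%:R * s.
Proof.
elim: n => [|n [a [b IHn]]]; first by exists 0%N, 0%N; rewrite expr1 mul1r.
exists (a.+1 + 2 * b.+1).-1, (a.+1 + b.+1).-1.
rewrite exprSr IHn !prednK ?addn_gt0 // !(natrD _ a.+1) natrM.
by ring: s2.
Qed.

Lemma unit_1_add_sqrt2 : 1 + s \is a GRing.unit.
Proof.
by apply/unitrPr; exists (s - 1); ring: s2.
Qed.

Lemma exp_1_add_sqrt2_neq1 n :
  characteristic0 A -> (1 + s) ^+ n.+1 <> 1.
Proof.
move=> charA; have [a [b ->]] := exp_1_add_sqrt2 n.
rewrite -[a.+1]addn1 natrD addrAC => /(canRL (addrK 1)); rewrite subrr.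
move=> /eqP; rewrite addr_eq0 => /eqP/(congr1 (fun x => x ^+ 2)).
rewrite sqrrN exprMn s2 -!natrX -natrM => eqR.
have inj_le (m k : nat) : m%:R = k%:R :> A -> (m <= k)%N.
  move=> mk; rewrite -subn_eq0; apply/eqP/charA.
  by case: (leqP k m) => [km|/ltnW/eqP ->] //; rewrite natrB // mk subrr.
have /eqP := @double_square_neq_square a b.+1 isT; apply.
by apply/eqP; rewrite mulnC eqn_leq !inj_le.
Qed.

End SquareRootOfTwo.

Lemma finite_units_exp (A : comUnitRingType) (finU : finite_set (units A))
    (x : A) : x \is a GRing.unit -> exists n, (x ^+ n.+1 = 1)%R.
Proof.
move=> Ux; pose u : unit_group finU := UnitGroup finU Ux.
have valX n : val (u ^+ n) = (x ^+ n)%R.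
  by elim: n => [|n IHn] //; rewrite expgS exprS -IHn.
by exists #[u].-1; rewrite -valX prednK ?order_gt0 // expg_order.
Qed.

Lemma exp4_neqN1 (A : comUnitRingType) (u : A) :
  characteristic0 A -> finite_set (units A) -> (u ^+ 4 <> -1)%R.
Proof.
move=> charA finU u4.
(* The square root of 2 is u + u^-1, and u^-1 = - u ^+ 3. *)
have s2 : ((u - u ^+ 3) ^+ 2 = 2%:R)%R by ring: u4.
by have [n /(exp_1_add_sqrt2_neq1 s2 charA)] :=
  finite_units_exp finU (unit_1_add_sqrt2 s2).
Qed.

Section CyclicFactors.

Variable gT : finGroupType.
Implicit Types (G P : {group gT}) (b : seq gT).

Lemma exponent2_cyclic_fourth_power (x y : gT) :
  8 %| #[x] -> y \in <[x]> -> y ^+ 2 = 1 ->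
  exists2 t, t \in <[x]> & y = t ^+ 4.
Proof.
move=> x8 /cycleP[k ->] /eqP; rewrite -expgM -order_dvdn => /(dvdn_trans x8).
rewrite (@dvdn_pmul2r 2 4) // => /dvdnP[m ->].
by exists (x ^+ m); rewrite ?mem_cycle // expgM.
Qed.

Lemma exponent2_fourth_power b P y :
    \big[dprod/1]_(x <- b) <[x]> = P -> all (fun x => 8 %| #[x]) b ->
    y \in P -> y ^+ 2 = 1 ->
  exists2 t, t \in P & y = t ^+ 4.
Proof.
elim: b P y => [|x b IHb] P y.
  by rewrite big_nil => <- _ /set1P -> _; exists 1; rewrite ?expg1n ?group1.
rewrite big_cons => defP /= /andP[x8 b8] Py y2.
have [[X Q defX defQ] _ cXQ tiXQ] := dprodP defP.
have [u [v [Xu Qv def_y _]]] := mem_dprod defP Py.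
rewrite defQ in cXQ tiXQ Qv; rewrite defX in cXQ tiXQ Xu.
have cuv : commute u v by apply/esym/(centsP cXQ).
have uv2 : u ^+ 2 * v ^+ 2 = 1 by rewrite -expgMn // -def_y.
(* The product being direct, both components of y have exponent 2. *)
have v2 : v ^+ 2 = 1.
  have: v ^+ 2 \in X :&: Q.
    by rewrite inE (groupX 2 Qv) andbT -(mulg1_eq uv2) groupV groupX.
  by rewrite tiXQ => /set1P.
have u2 : u ^+ 2 = 1 by rewrite -uv2 v2 mulg1.
have [|r Xr def_u] := exponent2_cyclic_fourth_power x8 _ u2; first by rewrite defX.
have [t Qt def_v] := IHb _ _ defQ b8 Qv v2.
exists (r * t).
  by rewrite -(dprodW defP) defX defQ mem_mulg // -defX.
rewrite def_y def_u def_v expgMn //; apply/esym/(centsP cXQ) => //.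
by rewrite -defX.
Qed.

(** Having exponent 2, [z] lies in the 2-Sylow subgroup; were all the cyclic
    factors of that subgroup of order at least 8, [z] would be a fourth power
    by [exponent2_fourth_power]. *)
Lemma epsilon_1or2 G z :
    abelian G -> z \in G -> z ^+ 2 = 1 -> (forall t, t \in G -> z <> t ^+ 4) ->
  epsilon G = 1%N \/ epsilon G = 2%N.
Proof.
move=> cGG Gz z2 z4; have [b [defP ob e_gt0]] := sylow2_exponents_exists cGG.
have sylP : 2.-Sylow(G) (sylow2 G) := svalP (Sylow_exists 2 G).
have sPG := pHall_sub sylP.
have Pz : z \in sylow2 G.
  rewrite (mem_normal_Hall sylP _ Gz); last by rewrite -sub_abelian_normal.
  by apply: (@pnat_dvd _ 2) => //; rewrite order_dvdn z2.
have [e e_in e_le2] : exists2 e, e \in sylow2_exponents G & e <= 2.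
  apply/hasP; apply: contraT; rewrite -all_predC => /allP/= e_gt2.
  suff b8 : all (fun x => 8 %| #[x]) b.
    have [t Pt] := exponent2_fourth_power defP b8 Pz z2.
    by move/z4; case; apply: (subsetP sPG).
  apply/allP => x xb; have : #[x] \in map order b by apply: map_f.
  rewrite ob => /mapP[e /e_gt2]; rewrite -ltnNge => e_ge3 ->.
  exact: (@dvdn_exp2l 2 3).
have min_in : epsilon G \in sylow2_exponents G.
  by apply: minimum_in; apply: contraTneq e_in => ->.
have := allP e_gt0 _ min_in; have := leq_trans (minimum_le e_in) e_le2.
by rewrite -/(epsilon G); case: (epsilon G) => [|[|[|k]]] //; [left | right].
Qed.

(** The complement of the chosen cyclic factor is the product of the other
    cyclic factors of the 2-Sylow subgroup and of the odd part of [G]. *)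
Lemma epsilon_cyclic_factor G :
    abelian G -> sylow2_exponents G != [::] ->
  exists (x : gT) (H : {group gT}), #[x] = (2 ^ epsilon G)%N /\ <[x]> \x H = G.
Proof.
move=> cGG e_n0; have [b [defP ob _]] := sylow2_exponents_exists cGG.
have /(map_f (expn 2)) := minimum_in e_n0.
rewrite -ob => /mapP[x xb ox]; exists x.
have := nilpotent_pcoreC 2 (abelian_nil cGG).
have sylP : 2.-Sylow(G) (sylow2 G) := svalP (Sylow_exists 2 G).
rewrite -(nilpotent_Hall_pcore (abelian_nil cGG) sylP) -defP (big_rem _ xb) /=.
rewrite -dprodA => defG; have [[_ H _ defH] _ _ _] := dprodP defG.
by exists H; split; [rewrite -ox | rewrite -defH].
Qed.

Lemma isog_cyclic_dprod_setX (x : gT) (H G : {group gT}) :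
  <[x]> \x H = G -> G \isog setX (Zp #[x]) H.
Proof.
move=> defG; apply: (isog_dprod defG (setX_dprod _ _)); last exact: isog_set1X.
by rewrite -(isog_transl _ (Zp_isog x)) isog_setX1.
Qed.

End CyclicFactors.

Theorem theoremC (A : comUnitRingType) (charA : characteristic0 A)
    (finU : finite_set (units A)) :
  let eps := epsilon [set: unit_group finU]%G in
  (eps = 1%N \/ eps = 2%N) /\
  exists (hT : finGroupType) (H : {group hT}),
    abelian H /\
    ([set: unit_group finU] \isog setX (Zp (2 ^ eps)) H)%g.
Proof.
move=> eps; have cUU := abelian_unit_group finU.
pose N1 : unit_group finU := UnitGroup finU (unitrN1 A).
have eps12 : eps = 1%N \/ eps = 2%N.
  apply: (@epsilon_1or2 _ [set: unit_group finU]%G N1) => // [|t _].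
    by apply: val_inj; rewrite /= mulrNN mulr1.
  move/(congr1 val) => t4; apply: (exp4_neqN1 (u := val t) charA finU).
  exact: esym t4.
split=> //; have [|x [H [ox defU]]] := epsilon_cyclic_factor cUU.
  by apply/eqP => e0; case: eps12; rewrite /eps /epsilon e0.
exists _, H; split; last by rewrite -ox; apply: isog_cyclic_dprod_setX.
by apply: abelianS cUU; apply: subsetT.
Qed.
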